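(* Let $A=\{(a,b):a,b\in\{0,1,2\}\}$ and $B=\{(a,b):a,b\in\{1,2,3\}\}$. Then the four mesh patterns $(123,A)$, $(132,A)$, $(123,B)$, $(132,B)$ are pairwise equidistributed, and the four mesh patterns $(123,A\cup\{(3,3)\})$, $(132,A\cup\{(3,3)\})$, $(123,B\cup\{(0,0)\})$, $(132,B\cup\{(0,0)\})$ are pairwise equidistributed.
   Context: $S_n$ denotes the set of permutations of $[n]=\{1,\dots,n\}$, written $\pi=\pi_1\cdots\pi_n$. A mesh pattern of length $k$ is a pair $(\tau,R)$ with $\tau\in S_k$ and $R\subseteq\{0,1,\dots,k\}^2$ (the shaded boxes; box $(a,b)$ is the unit square $[a,a+1]\times[b,b+1]$ in the diagram of $\tau$). An occurrence of $(\tau,R)$ in $\pi\in S_n$ is a choice of indices $i_1<\dots<i_k$ such that $\pi_{i_1}\cdots\pi_{i_k}$ is order-isomorphic to $\tau$ and, with $i_0=0$, $i_{k+1}=n+1$, $v_1<\dots<v_k$ the values $\pi_{i_1},\dots,\pi_{i_k}$ sorted increasingly, $v_0=0$, $v_{k+1}=n+1$, for every $(a,b)\in R$ there is no index $m$ with $i_a<m<i_{a+1}$ and $v_b<\pi_m<v_{b+1}$. Mesh patterns $p,q$ are equidistributed (have the same distribution) if for all $n,\ell\ge0$ the number of $\pi\in S_n$ with exactly $\ell$ occurrences of $p$ equals the number with exactly $\ell$ occurrences of $q$. *)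

(* Defs.v *)
From mathcomp Require Import all_boot all_fingroup.

Set Implicit Arguments.
Unset Strict Implicit.
Unset Printing Implicit Defensive.

(* Permutations of [n] are elements of 'S_n, hence 0-based: the one-line
   notation of pi is pi_(i+1) = (pi i).+1.  The successors in
   bounded_positions, bounded_values and cell_empty translate back to the
   1-based convention, in which 0 and n + 1 are the sentinels i_0 = v_0 and
   i_(k+1) = v_(k+1).  Boxes keep their coordinates in {0, ..., k}. *)

Definition mesh_pattern (k : nat) : Type :=
  ('S_k * {set 'I_k.+1 * 'I_k.+1})%type.

Section Occurrences.

Variables (k n : nat) (pi : 'S_n).

(* An increasing choice of indices is encoded as a function f : 'I_k -> 'I_n. *)
Definition increasing (f : {ffun 'I_k -> 'I_n}) : bool :=
  [forall i : 'I_k, forall j : 'I_k, (i < j) ==> (f i < f j)].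

Definition order_iso (tau : 'S_k) (f : {ffun 'I_k -> 'I_n}) : bool :=
  [forall i : 'I_k, forall j : 'I_k, (tau i < tau j) == (pi (f i) < pi (f j))].

(* The sequences i_0, ..., i_(k+1) and v_0, ..., v_(k+1). *)
Definition bounded_positions (f : {ffun 'I_k -> 'I_n}) : seq nat :=
  0 :: rcons [seq (f i).+1 | i : 'I_k] n.+1.

Definition bounded_values (f : {ffun 'I_k -> 'I_n}) : seq nat :=
  0 :: rcons (sort leq [seq (pi (f i)).+1 | i : 'I_k]) n.+1.

Definition cell_empty (f : {ffun 'I_k -> 'I_n}) (c : 'I_k.+1 * 'I_k.+1) : bool :=
  let x := nth 0 (bounded_positions f) in
  let v := nth 0 (bounded_values f) in
  [forall m : 'I_n,
     ~~ ((x c.1 < m.+1 < x c.1.+1) && (v c.2 < (pi m).+1 < v c.2.+1))].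

Definition occurrence (p : mesh_pattern k) (f : {ffun 'I_k -> 'I_n}) : bool :=
  [&& increasing f, order_iso p.1 f & [forall c in p.2, cell_empty f c]].

Definition num_occurrences (p : mesh_pattern k) : nat :=
  #|[set f : {ffun 'I_k -> 'I_n} | occurrence p f]|.

End Occurrences.

Definition equidistributed (k k' : nat)
    (p : mesh_pattern k) (q : mesh_pattern k') : Prop :=
  forall n l : nat,
    #|[set pi : 'S_n | num_occurrences pi p == l]| =
    #|[set pi : 'S_n | num_occurrences pi q == l]|.

Definition perm123 : 'S_3 := 1%g.
Definition perm132 : 'S_3 := tperm (inord 1) (inord 2).

Lemma one_line_perm123 : [seq (perm123 i).+1 | i : 'I_3] = [:: 1; 2; 3].
Proof. by rewrite /image_mem !enum_ordSl enum_ord0 /= !perm1. Qed.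

Lemma one_line_perm132 : [seq (perm132 i).+1 | i : 'I_3] = [:: 1; 3; 2].
Proof.
rewrite /image_mem !enum_ordSl enum_ord0 /= !permE /=.
by rewrite -!val_eqE /= !inordK //= !inordK.
Qed.

Definition boxA : {set 'I_4 * 'I_4} :=
  [set c : 'I_4 * 'I_4 | (c.1 <= 2) && (c.2 <= 2)].
Definition boxB : {set 'I_4 * 'I_4} :=
  [set c : 'I_4 * 'I_4 | (1 <= c.1) && (1 <= c.2)].
Definition box00 : 'I_4 * 'I_4 := (ord0, ord0).
Definition box33 : 'I_4 * 'I_4 := (ord_max, ord_max).

(* Main.v *)
(* Reversal-complement reduces (123,B) and (132,B) to (123,A) and (213,A).  An
   occurrence of (123,A), (213,A) or (132,A) is determined by its last position
   z and its largest value v, since the other two letters are then the only ones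
   in the lower left box.

   Build a permutation by appending letters one at a time, the new one having
   rank j = 0, 1, 2, ... among those present, and remember whether the two
   smallest letters ascend.  They descend after j = 0, ascend after j = 1, and
   are not affected by j >= 2.  The new letter ends an occurrence of

     (123,A) iff they ascend and j = 2,
     (132,A) iff they ascend and j = 1,
     (213,A) iff they descend and j = 2,

   always with v = 2.  Hence exchanging the ranks 1 and 2 whenever the two
   smallest letters ascend turns (123,A) into (132,A), and exchanging the ranks
   0 and 1 everywhere turns (123,A) into (213,A).  Neither changes the pairs
   (z, v) of old occurrences, which have v >= 2, nor whether the new letter
   exceeds v, which is what an additional shaded box (3,3) forbids. *)

Require Import Defs.
From mathcomp Require Import all_boot all_fingroup.
From mathcomp Require Import zify.

Set Implicit Arguments.
Unset Strict Implicit.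
Unset Printing Implicit Defensive.

(** * Order types, occurrences as triples of positions, and the state of the two smallest letters *)

Definition ord123 (a b c : nat) := (a < b) && (b < c).
Definition ord213 (a b c : nat) := (b < a) && (a < c).
Definition ord132 (a b c : nat) := (a < c) && (c < b).

(** [bump j] is how old values are relabelled when a letter of rank [j] arrives, so this is
    invariance under the only relabellings that appending letters produces. *)
Definition order_invariant (o : nat -> nat -> nat -> bool) : Prop :=
  forall j a b c, o (bump j a) (bump j b) (bump j c) = o a b c.

(* An occurrence, at positions x < y < z, of the pattern with shading A whose
   order type is o; the flag g adds the box (3,3).  For the three order types
   used, the largest value is never at x. *)
Definition triple (o : nat -> nat -> nat -> bool) (g : bool) n (pi : 'S_n)
    (x y z : 'I_n) : bool :=
  [&& x < y, y < z, o (pi x) (pi y) (pi z),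
      [forall m : 'I_n, (m < z) && (pi m < maxn (pi y) (pi z)) ==>
                        (m == x) || (m == y)]
    & g ==> [forall m : 'I_n, (z < m) ==> (pi m < maxn (pi y) (pi z))]].

Lemma tripleP (o : nat -> nat -> nat -> bool) (g : bool) n (pi : 'S_n) (x y z : 'I_n) :
  reflect [/\ x < y, y < z, o (pi x) (pi y) (pi z),
     forall m : 'I_n, m < z -> pi m < maxn (pi y) (pi z) -> m = x \/ m = y
   & g -> forall m : 'I_n, z < m -> pi m < maxn (pi y) (pi z)]
  (triple o g pi x y z).
Proof.
apply: (iffP and5P) => [[xy yz oxyz /forallP box /implyP good]|[xy yz oxyz box good]];
  split=> //.
- move=> m mz mv; have /implyP := box m; rewrite mz mv => /(_ isT).
  by case/orP=> /eqP; [left | right].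
- by move=> /good/forallP good' m zm; have /implyP := good' m; apply.
- apply/forallP=> m; apply/implyP=> /andP[mz mv].
  by have [->|->] := box m mz mv; rewrite eqxx ?orbT.
- by apply/implyP=> /good good'; apply/forallP=> m; apply/implyP; apply: good'.
Qed.

(** These pairs stand in for the occurrences: [triple_inj] shows that they determine the triple.
    Unlike triples, they can be compared between different order types. *)
Definition top_right (o : nat -> nat -> nat -> bool) (g : bool) n (pi : 'S_n) :
    {set 'I_n * 'I_n} :=
  [set p : 'I_n * 'I_n | [exists x : 'I_n, exists y : 'I_n,
     triple o g pi x y p.1 && (p.2 == maxn (pi y) (pi p.1) :> nat)]].

Lemma top_rightP o g n (pi : 'S_n) (z v : 'I_n) :
  reflect (exists x y, triple o g pi x y z /\ v = maxn (pi y) (pi z) :> nat)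
          ((z, v) \in top_right o g pi).
Proof.
rewrite inE; apply: (iffP existsP) => [[x /existsP[y /andP[t /eqP e]]]|[x [y [t e]]]].
  by exists x, y.
by exists x; apply/existsP; exists y; rewrite t e eqxx.
Qed.

(** For [n <= 1] this is false, since there are no two letters to compare. *)
Definition smallest_ascend n (pi : 'S_n) : bool :=
  [exists x : 'I_n, exists y : 'I_n,
     [&& x < y, pi x == 0 :> nat & pi y == 1 :> nat]].

Lemma smallest_ascendP n (pi : 'S_n) :
  reflect (exists x y : 'I_n, [/\ x < y, pi x = 0 :> nat & pi y = 1 :> nat])
          (smallest_ascend pi).
Proof.
apply: (iffP existsP) => [[x /existsP[y /and3P[xy /eqP x0 /eqP y1]]]|].
  by exists x, y.
by move=> [x [y [xy x0 y1]]]; exists x; apply/existsP; exists y; rewrite xy x0 y1.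
Qed.

Lemma perm_preim n (pi : 'S_n) k : k < n -> exists x : 'I_n, pi x = k :> nat.
Proof. by move=> kn; exists ((pi^-1)%g (Ordinal kn)); rewrite permKV. Qed.

Lemma ltn_bump j a b : (bump j a < bump j b) = (a < b).
Proof. by rewrite !ltnNge leq_bump2. Qed.

Lemma maxn_bump j a b : maxn (bump j a) (bump j b) = bump j (maxn a b).
Proof. by rewrite /maxn ltn_bump; case: ifP. Qed.

Lemma ord123_bump : order_invariant ord123.
Proof. by move=> j a b c; rewrite /ord123 !ltn_bump. Qed.

Lemma ord213_bump : order_invariant ord213.
Proof. by move=> j a b c; rewrite /ord213 !ltn_bump. Qed.

Lemma ord132_bump : order_invariant ord132.
Proof. by move=> j a b c; rewrite /ord132 !ltn_bump. Qed.

Lemma lt_lift_max n (x y : 'I_n) :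
  (lift ord_max x < lift ord_max y) = (x < y).
Proof. by rewrite /= ltn_bump. Qed.

(** * Appending a last letter of rank [j] *)

Section Insert.

Variables (o : nat -> nat -> nat -> bool) (g : bool) (n : nat) (j : 'I_n.+1) (s : 'S_n).
Let pi := lift_perm ord_max j s.

Let valL x : pi (lift ord_max x) = bump j (s x) :> nat.
Proof. by rewrite lift_perm_lift. Qed.

Let valM : pi ord_max = j.
Proof. by rewrite lift_perm_id. Qed.

Lemma smallest_ascend_insert :
  smallest_ascend pi = if j <= 1 then j == 1 :> nat else smallest_ascend s.
Proof.
apply/smallest_ascendP/idP.
  move=> [x [y [xy x0 y1]]]; move: xy x0 y1.
  case: (unliftP ord_max x) => [x'|] ->; last first.
    by have := ltn_ord y; rewrite /= ltnS leqNgt => /negP.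
  case: (unliftP ord_max y) => [y'|] ->; last first.
    by rewrite valM => _ _ ->.
  rewrite !valL lt_lift_max /bump => xy x0 y1; case: ifP => [|_]; first lia.
  by apply/smallest_ascendP; exists x', y'; split=> //; lia.
case: ifP => [_ /eqP j1 | jgt /smallest_ascendP[x [y [xy x0 y1]]]].
  have /(perm_preim s)[x x0] : 0 < n by have := ltn_ord j; lia.
  exists (lift ord_max x), ord_max; rewrite valL valM j1 x0; split=> //.
  by rewrite lift_max.
by exists (lift ord_max x), (lift ord_max y); rewrite lt_lift_max !valL x0 y1 /bump;
   split=> //; lia.
Qed.


(** The new letter lies to the right of [z], so it meets no box of A. It can only fall into box
    (3,3), and it does so exactly when its rank exceeds the old largest value. *)
Lemma triple_insert (x y z : 'I_n) : order_invariant o ->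
  triple o g pi (lift ord_max x) (lift ord_max y) (lift ord_max z) =
  triple o g s x y z && (g ==> (j <= maxn (s y) (s z))).
Proof.
move=> o_inv; apply/tripleP/andP.
  rewrite !lt_lift_max !valL o_inv maxn_bump => -[xy yz oxyz box good]; split.
    apply/tripleP; split=> // [m|gT m].
      rewrite -lt_lift_max -[s m < _](ltn_bump j) -valL => mz mv.
      by have [/lift_inj ->|/lift_inj ->] := box _ mz mv; [left | right].
    rewrite -lt_lift_max -[s m < _](ltn_bump j) -valL => zm.
    exact: good.
  apply/implyP=> /good/(_ ord_max); rewrite lift_max valM ltn_ord => /(_ isT).
  by rewrite /bump; lia.
move=> [/tripleP[xy yz oxyz box good] /implyP jle].
rewrite !lt_lift_max !valL o_inv maxn_bump; split=> // [m|gT m].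
  case: (unliftP ord_max m) => [m'|] -> ; last first.
    by have := ltn_ord (lift ord_max z); rewrite {1}ltnS leqNgt => /negPf ->.
  rewrite lt_lift_max valL ltn_bump => mz mv.
  by have [->|->] := box _ mz mv; [left | right].
case: (unliftP ord_max m) => [m'|] -> ; last first.
  by move=> _; have := jle gT; rewrite valM /bump; lia.
by rewrite lt_lift_max valL ltn_bump; apply: good.
Qed.

(** All old positions precede the new one and all values below [n] are attained, so emptiness of the
    lower left region becomes a condition on values [k] alone. Box (3,3) lies beyond the last
    position, hence is empty whatever [g] is. *)
Lemma triple_last (x y : 'I_n) :
  reflect [/\ x < y, o (bump j (s x)) (bump j (s y)) j &
    forall k, k < n -> bump j k < maxn (bump j (s y)) j -> k = s x \/ k = s y]
  (triple o g pi (lift ord_max x) (lift ord_max y) ord_max).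
Proof.
apply: (iffP (tripleP _ _ _ _ _ _)).
  rewrite !lt_lift_max !valL valM => -[xy _ oxy box _]; split=> // k kn kv.
  have [m mk] := perm_preim s kn.
  have /box : lift ord_max m < @ord_max n by rewrite lift_max.
  rewrite valL mk => /(_ kv)[] /lift_inj <-; rewrite mk; by [left | right].
rewrite !lt_lift_max !valL valM => -[xy oxy box]; split=> //.
- by rewrite lift_max.
- move=> m; case: (unliftP ord_max m) => [m'|] ->; last by rewrite ltnn.
  rewrite valL => _ /box[] //.
    by move/val_inj/perm_inj ->; left.
  by move/val_inj/perm_inj ->; right.
- by move=> _ m; rewrite /= ltnNge -ltnS ltn_ord.
Qed.

(* The effect on top_right of appending a letter of rank j.  The guard 1 < q.2
   is always true for q in top_right; it makes the set insensitive to permuting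
   the ranks 0, 1 and 2. *)
Definition insert_pairs (hit : bool) (E : {set 'I_n * 'I_n}) :
    {set 'I_n.+1 * 'I_n.+1} :=
  [set p : 'I_n.+1 * 'I_n.+1 | [exists q : 'I_n * 'I_n,
          [&& q \in E, 1 < q.2, g ==> (j <= q.2),
              p.1 == lift ord_max q.1 & p.2 == lift j q.2]]
           || [&& hit, p.1 == ord_max & p.2 == 2 :> nat]].

Lemma top_right_gt1 (z v : 'I_n) :
  (forall a b c, o a b c -> a < maxn b c) -> (z, v) \in top_right o g s -> 1 < v.
Proof.
move=> o_top /top_rightP[x [y [/tripleP[xy yz /o_top xtop _ _] v_def]]].
have neq (a b : 'I_n) : a < b -> s a <> s b :> nat.
  by move=> ab /val_inj/perm_inj e; rewrite e ltnn in ab.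
have := neq _ _ xy; have := neq _ _ yz; have := neq _ _ (ltn_trans xy yz); lia.
Qed.

(** The part that depends on the order type is isolated in the hypothesis on [hit], which governs
    pairs at the new position. Pairs at old positions are handled uniformly by [triple_insert]:
    their value is relabelled, and they survive unless the new letter enters a shaded box (3,3). *)
Lemma top_right_insert (hit : bool) :
  order_invariant o -> (forall a b c, o a b c -> a < maxn b c) ->
  (forall v : nat,
     (exists x y : 'I_n, triple o g pi (lift ord_max x) (lift ord_max y) ord_max
       /\ v = maxn (bump j (s y)) j) <-> hit /\ v = 2) ->
  top_right o g pi = insert_pairs hit (top_right o g s).
Proof.
move=> o_inv o_top hitP; apply/setP=> -[z v]; rewrite [in RHS]inE /=.
case: (unliftP ord_max z) => [z'|] ->; last first.
  rewrite eqxx /= (_ : [exists q, _] = false) /=; last first.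
    apply/existsP=> -[q /and5P[_ _ _ /eqP/(congr1 val)/= e _]].
    by have := ltn_ord q.1; rewrite /bump in e; lia.
  apply/top_rightP/andP => [[x [y [t e]]]|[h /eqP v2]].
    have /tripleP[xy yz _ _ _] := t.
    have := ltn_trans xy yz; move: yz t e {xy}.
    case: (unliftP ord_max x) => [x'|] ->; last by rewrite ltnn.
    case: (unliftP ord_max y) => [y'|] -> ; last by rewrite ltnn.
    rewrite valL valM => _ t e _; have [] := (hitP v).1; last by move=> -> ->.
    by exists x', y'.
  have [x [y [t e]]] := (hitP 2).2 (conj h erefl).
  by exists (lift ord_max x), (lift ord_max y); rewrite valL valM v2.
rewrite (_ : lift _ _ == _ = false) ?andbF ?orbF; last first.
  by apply/eqP=> /(congr1 val)/=; have := ltn_ord z'; rewrite /bump; lia.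
apply/top_rightP/existsP => [[x [y [t e]]]|[[z0 v0]]].
  have /tripleP[xy yz _ _ _] := t.
  have := ltn_trans xy yz; move: yz t e {xy}.
  have nle : (@ord_max n < lift ord_max z') = false.
    by rewrite ltnNge -ltnS ltn_ord.
  case: (unliftP ord_max x) => [x'|] ->; last by rewrite nle.
  case: (unliftP ord_max y) => [y'|] -> ; last by rewrite nle.
  rewrite !valL triple_insert // maxn_bump => _ /andP[t jle] e _.
  have [v' v'E] : exists v' : 'I_n, v' = maxn (s y') (s z') :> nat.
    by rewrite /maxn; case: ifP => _; [exists (s z') | exists (s y')].
  have v'in : (z', v') \in top_right o g s by apply/top_rightP; exists x', y'.
  exists (z', v'); rewrite /= v'in (top_right_gt1 o_top v'in) v'E jle eqxx /=.
  by rewrite -val_eqE /= v'E e.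
case/and5P=> /top_rightP[x [y [t e]]] /= _ jle /eqP/lift_inj zE /eqP ->.
subst z0; exists (lift ord_max x), (lift ord_max y).
by rewrite triple_insert // !valL maxn_bump t -e.
Qed.

End Insert.

(** * Which ranks complete an occurrence, for each order type *)

Section InsertByPattern.

Variables (g : bool) (n : nat) (j : 'I_n.+1) (s : 'S_n).
Let pi := lift_perm ord_max j s.

Let s_inj (x y : 'I_n) : x < y -> s x <> s y :> nat.
Proof. by move=> xy /val_inj/perm_inj e; rewrite e ltnn in xy. Qed.

Lemma top_right123_insert :
  top_right ord123 g pi =
  insert_pairs g j (smallest_ascend s && (j == 2 :> nat)) (top_right ord123 g s).
Proof.
apply: (top_right_insert ord123_bump) => [a b c|v]; first by rewrite /ord123; lia.
have jn := ltn_ord j; split=> [[x [y [/triple_last[xy o box] ve]]]|].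
  have xn := ltn_ord (s x); have yn := ltn_ord (s y).
  (* The new letter is the largest, so every [k < j] is one of the two values at [x] and [y].
     Testing 0, 1 and 2 forces these values to be 0 and 1, and [j = 2]. *)
  have b0 := box 0; have b1 := box 1; have b2 := box 2.
  rewrite /ord123 /bump in o b0 b1 b2 ve.
  have [sx sy] : s x = 0 :> nat /\ s y = 1 :> nat by lia.
  split; last by lia.
  by apply/andP; split; [apply/smallest_ascendP; exists x, y | lia].
move=> [/andP[/smallest_ascendP[x [y [xy sx sy]]] /eqP j2] ->].
exists x, y; rewrite sy j2; split=> //.
apply/triple_last; rewrite sx sy j2; split=> // k _; rewrite /bump; lia.
Qed.

Lemma top_right132_insert :
  top_right ord132 g pi =
  insert_pairs g j (smallest_ascend s && (j == 1 :> nat)) (top_right ord132 g s).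
Proof.
apply: (top_right_insert ord132_bump) => [a b c|v]; first by rewrite /ord132; lia.
have jn := ltn_ord j; split=> [[x [y [/triple_last[xy o box] ve]]]|].
  have xn := ltn_ord (s x); have yn := ltn_ord (s y).
  (* Now the letter at [y] is the largest, and below it there are only the letter at [x] and the new
     one. This forces old values 0 and 1 at [x] and [y], and [j = 1]; the value at [y] then rises to
     2. *)
  have b0 := box 0; have b1 := box 1; have b2 := box 2.
  rewrite /ord132 /bump in o b0 b1 b2 ve.
  have [sx sy] : s x = 0 :> nat /\ s y = 1 :> nat by have := s_inj xy; lia.
  split; last by lia.
  by apply/andP; split; [apply/smallest_ascendP; exists x, y | lia].
move=> [/andP[/smallest_ascendP[x [y [xy sx sy]]] /eqP j2] ->].
exists x, y; rewrite sy j2; split=> //.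
apply/triple_last; rewrite sx sy j2; split=> // k _; rewrite /bump; lia.
Qed.

Lemma top_right213_insert :
  top_right ord213 g pi =
  insert_pairs g j (~~ smallest_ascend s && (j == 2 :> nat)) (top_right ord213 g s).
Proof.
apply: (top_right_insert ord213_bump) => [a b c|v]; first by rewrite /ord213; lia.
have jn := ltn_ord j; split=> [[x [y [/triple_last[xy o box] ve]]]|].
  have xn := ltn_ord (s x); have yn := ltn_ord (s y).
  have b0 := box 0; have b1 := box 1; have b2 := box 2.
  rewrite /ord213 /bump in o b0 b1 b2 ve.
  have [sx sy] : s x = 1 :> nat /\ s y = 0 :> nat by lia.
  split; last by lia.
  apply/andP; split; last lia.
  apply/smallest_ascendP=> -[x' [y' [xy' sx' sy']]].
  have ex : x' = y by apply/(@perm_inj _ s)/val_inj; rewrite /= sx' sy.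
  have ey : y' = x by apply/(@perm_inj _ s)/val_inj; rewrite /= sy' sx.
  by rewrite ex ey in xy'; lia.
move=> [/andP[desc /eqP j2] ->].
(* Rank 2 is available only if [n >= 2], so the old values 0 and 1 both occur. *)
have [y sy] : exists y, s y = 0 :> nat by apply: perm_preim; lia.
have [x sx] : exists x, s x = 1 :> nat by apply: perm_preim; lia.
have xy : x < y.
  have [//|yx|/val_inj e] := ltngtP x y; last by rewrite e in sx; lia.
  by case/smallest_ascendP: desc; exists y, x.
exists x, y; rewrite sy j2; split=> //.
apply/triple_last; rewrite sx sy j2; split=> // k _; rewrite /bump; lia.
Qed.

End InsertByPattern.

(** * Transport of the joint distribution by exchanging ranks *)

Lemma sum_insert n (F : 'S_n.+1 -> nat) :
  \sum_pi F pi = \sum_(s : 'S_n) \sum_j F (lift_perm ord_max j s).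
Proof.
rewrite pair_big /=; apply: (reindex (fun p : 'S_n * 'I_n.+1 => lift_perm ord_max p.2 p.1)).
(* Bijectivity follows from injectivity and the count (n+1)! = (n+1) n!. *)
apply/onW_bij/inj_card_bij => [[s j] [s' j'] /= e|]; last first.
  by rewrite card_prod !card_Sn card_ord factS mulnC.
have ej : j = j' by have := congr1 (fun pi : 'S_n.+1 => pi ord_max) e; rewrite !lift_perm_id.
rewrite -ej in e *; congr pair; apply/permP=> x.
have := congr1 (fun pi : 'S_n.+1 => pi (lift ord_max x)) e.
by rewrite !lift_perm_lift => /lift_inj.
Qed.

(** The guard leaves only values [q.2 >= 2]. Inserting at any rank at most 2 shifts all of these by
    one and never exceeds them. *)
Lemma insert_pairs_swap g n (j j' : 'I_n.+1) hit (E : {set 'I_n * 'I_n}) :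
  j <= 2 -> j' <= 2 -> insert_pairs g j hit E = insert_pairs g j' hit E.
Proof.
move=> j2 j'2; apply/setP=> p; rewrite !inE; congr (_ || _).
apply: eq_existsb => q; case: (ltnP 1 q.2) => [q2|]; rewrite ?andbF //.
have -> : lift j q.2 = lift j' q.2 by apply: val_inj; rewrite /= /bump !(leq_trans _ q2).
by rewrite !(leq_trans _ q2).
Qed.

Lemma top_right_small o g n (pi : 'S_n) : n <= 2 -> top_right o g pi = set0.
Proof.
move=> n2; apply/setP=> -[z v]; rewrite in_set0; apply/negbTE/negP.
case/top_rightP=> x [y [/tripleP[xy yz _ _ _] _]].
by have := ltn_ord z; lia.
Qed.

Section Transport.

Variable g : bool.

(* Summing an arbitrary G against the pair (state, top_right) expresses equality
   of the joint distributions and makes the induction go through. *)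
Lemma sum_top_right132 n (G : bool -> {set 'I_n * 'I_n} -> nat) :
  \sum_(s : 'S_n) G (smallest_ascend s) (top_right ord132 g s) =
  \sum_(s : 'S_n) G (smallest_ascend s) (top_right ord123 g s).
Proof.
elim: n G => [|n IHn] G; first by apply: eq_bigr => s _; rewrite !top_right_small.
(* Rank 2 exists only from [n = 2] on; below that, permutations of length [n.+1] have no room for an
   occurrence. *)
have [n1|n2] := leqP n 1.
  by apply: eq_bigr => s _; rewrite !top_right_small.
(* The sum over the last rank depends on [s] only through its state and its pairs, so the induction
   hypothesis applies with [H] in place of [G]. *)
pose H b E := \sum_(j < n.+1)
  G (if j <= 1 then j == 1 :> nat else b) (insert_pairs g j (b && (j == 1 :> nat)) E).
rewrite !sum_insert (eq_bigr (fun s => H (smallest_ascend s) (top_right ord132 g s)));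
  last first.
  by move=> s _; apply: eq_bigr => j _; rewrite smallest_ascend_insert top_right132_insert.
rewrite IHn; apply: eq_bigr => s _; rewrite /H.
pose i1 : 'I_n.+1 := inord 1; pose i2 : 'I_n.+1 := inord 2.
have i1E : i1 = 1 :> nat by rewrite inordK //; lia.
have i2E : i2 = 2 :> nat by rewrite inordK //; lia.
(* If the smallest letters of [s] ascend, they still ascend after rank 1 and after rank 2. The
   exchange thus preserves the state and moves the completed occurrence from one rank to the
   other. *)
rewrite (reindex_inj (@perm_inj _ (if smallest_ascend s then tperm i1 i2 else 1%g))).
apply: eq_bigr => j _; rewrite smallest_ascend_insert top_right123_insert.
case: (smallest_ascend s) => /=; last by rewrite perm1.
case: tpermP => [->|->|j1 j2]; rewrite ?i1E ?i2E /=.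
- by congr G; apply: insert_pairs_swap; rewrite ?i1E ?i2E.
- by congr G; apply: insert_pairs_swap; rewrite ?i1E ?i2E.
have -> : (j == 1 :> nat) = false.
  by apply/eqP=> e; case: j1; apply: val_inj; rewrite /= e i1E.
by have -> : (j == 2 :> nat) = false;
  first by apply/eqP=> e; case: j2; apply: val_inj; rewrite /= e i2E.
Qed.

(** Exchanging ranks 0 and 1 at every stage flips the state, which is why it is negated on the
    right. For [n <= 1] the state is always false and a negated state could not match. *)
Lemma sum_top_right213 n (G : bool -> {set 'I_n * 'I_n} -> nat) : 1 < n ->
  \sum_(s : 'S_n) G (smallest_ascend s) (top_right ord213 g s) =
  \sum_(s : 'S_n) G (~~ smallest_ascend s) (top_right ord123 g s).
Proof.
elim: n G => [//|n IHn] G; rewrite ltnS => n0.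
pose H b E := \sum_(j < n.+1)
  G (if j <= 1 then j == 1 :> nat else b) (insert_pairs g j (~~ b && (j == 2 :> nat)) E).
rewrite !sum_insert (eq_bigr (fun s => H (smallest_ascend s) (top_right ord213 g s)));
  last first.
  by move=> s _; apply: eq_bigr => j _; rewrite smallest_ascend_insert top_right213_insert.
have -> : \sum_(s : 'S_n) H (smallest_ascend s) (top_right ord213 g s) =
          \sum_(s : 'S_n) H (~~ smallest_ascend s) (top_right ord123 g s).
  have [n1|n1] := ltnP 1 n; first exact: IHn.
  apply: eq_bigr => s _; rewrite !top_right_small ?(leq_trans n1) //.
  apply: eq_bigr => j _; have jn := ltn_ord j.
  have -> : j <= 1 by lia.
  by have -> : (j == 2 :> nat) = false; [lia | rewrite !andbF].
apply: eq_bigr => s _; rewrite /H.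
pose i1 : 'I_n.+1 := inord 1; pose i0 : 'I_n.+1 := ord0.
have i1E : i1 = 1 :> nat by rewrite inordK //; lia.
(* Ranks 0 and 1 create opposite states and complete no occurrence; larger ranks inherit the
   negation. *)
rewrite (reindex_inj (@perm_inj _ (tperm i0 i1))).
apply: eq_bigr => j _; rewrite smallest_ascend_insert top_right123_insert negbK.
case: tpermP => [->|->|j0 j1]; rewrite ?i1E /= ?andbF.
- by congr G; apply: insert_pairs_swap; rewrite ?i1E.
- by congr G; apply: insert_pairs_swap; rewrite ?i1E.
have j1E : (j == 1 :> nat) = false.
  by apply/eqP=> e; case: j1; apply: val_inj; rewrite /= e i1E.
have j0E : (j == 0 :> nat) = false.
  by apply/eqP=> e; case: j0; apply: val_inj; rewrite /= e.
by have -> : (j <= 1) = false by lia.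
Qed.

Definition num_top_right o n l : nat :=
  #|[set pi : 'S_n | #|top_right o g pi| == l]|.

Lemma num_top_right132 n l : num_top_right ord132 n l = num_top_right ord123 n l.
Proof.
rewrite /num_top_right -!sum1dep_card big_mkcond [RHS]big_mkcond /=.
exact: (sum_top_right132 (fun _ E => if #|E| == l then 1 else 0)).
Qed.

Lemma num_top_right213 n l : num_top_right ord213 n l = num_top_right ord123 n l.
Proof.
rewrite /num_top_right -!sum1dep_card big_mkcond [RHS]big_mkcond /=.
have [n1|n1] := ltnP 1 n.
  exact: (sum_top_right213 (fun _ E => if #|E| == l then 1 else 0)).
by apply: eq_bigr => s _; rewrite !top_right_small // (leq_trans n1).
Qed.

End Transport.

(** * From shaded boxes to conditions on triples *)

Definition i0 : 'I_3 := ord0.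
Definition i1 : 'I_3 := lift ord0 ord0.
Definition i2 : 'I_3 := ord_max.

Lemma val_ord3 : [/\ i0 = 0 :> nat, i1 = 1 :> nat & i2 = 2 :> nat].
Proof. by []. Qed.

Lemma forall_ord3 (P : 'I_3 -> Prop) : (forall i, P i) <-> [/\ P i0, P i1 & P i2].
Proof.
split=> [PP|[P0 P1 P2] i]; first by split.
by case: i => [[|[|[|m]]] lt_m] //;
   [have -> : Ordinal lt_m = i0 by apply: val_inj
   |have -> : Ordinal lt_m = i1 by apply: val_inj
   |have -> : Ordinal lt_m = i2 by apply: val_inj].
Qed.

Lemma perm132_val : [/\ perm132 i0 = 0 :> nat, perm132 i1 = 2 :> nat
  & perm132 i2 = 1 :> nat].
Proof.
have e1 : inord 1 = i1 by apply: val_inj; rewrite /= inordK.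
have e2 : inord 2 = i2 by apply: val_inj; rewrite /= inordK.
by rewrite /perm132 e1 e2 tpermL tpermR tpermD.
Qed.

Definition boxesA (g : bool) := if g then boxA :|: [set box33] else boxA.
Definition boxesB (g : bool) := if g then boxB :|: [set box00] else boxB.

(** The condition on a single letter, stated for plain numbers so that the geometry of the grid
    becomes linear arithmetic. *)
Definition box_free (R : {set 'I_4 * 'I_4}) (X V : seq nat) (m p : nat) : Prop :=
  forall c, c \in R ->
    ~ ((nth 0 X c.1 < m < nth 0 X c.1.+1) && (nth 0 V c.2 < p < nth 0 V c.2.+1)).

Lemma boxesAP g (a b : 'I_4) :
  ((a, b) \in boxesA g) = (a <= 2) && (b <= 2) || [&& g, a == 3 :> nat & b == 3 :> nat].
Proof. by case: g; rewrite !inE ?orbF. Qed.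

Lemma boxesBP g (a b : 'I_4) :
  ((a, b) \in boxesB g) = (1 <= a) && (1 <= b) || [&& g, a == 0 :> nat & b == 0 :> nat].
Proof. by case: g; rewrite !inE ?orbF. Qed.

Section BoxFree.

Variables x y z v1 v2 v3 N m p : nat.
Hypotheses (xyz : x < y < z) (v123 : v1 < v2 < v3).
Hypotheses (m_gt0 : 0 < m < N) (p_gt0 : 0 < p < N).
Let X := [:: 0; x; y; z; N].
Let V := [:: 0; v1; v2; v3; N].

(** The boxes of A fill the quadrant left of [z] and below [v3], except for the grid lines at [x],
    [y], [v1] and [v2]; a letter there must lie on one of these lines. *)
Lemma box_freeA g :
  box_free (boxesA g) X V m p <->
  (m < z -> p < v3 -> m = x \/ m = y \/ p = v1 \/ p = v2) /\ (g -> z < m -> p <= v3).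
Proof.
split=> [free|[box good] [a b]].
  split=> [mz pv3|gT zm].
    (* Column and row of the box that contains a point off the grid lines. *)
    pose a : nat := if m < x then 0 else if m < y then 1 else 2.
    pose b : nat := if p < v1 then 0 else if p < v2 then 1 else 2.
    have [ma|] := boolP (m \in [:: x; y]).
      by rewrite !inE in ma; case/orP: ma => /eqP; tauto.
    have [pb _|] := boolP (p \in [:: v1; v2]).
      by rewrite !inE in pb; case/orP: pb => /eqP; tauto.
    rewrite !inE !negb_or => /andP[p1 p2] /andP[m1 m2].
    have a3 : a <= 2 by rewrite /a; do !case: ifP => // _.
    have b3 : b <= 2 by rewrite /b; do !case: ifP => // _.
    case: (free (inord a, inord b)); first by rewrite boxesAP !inordK ?a3 ?b3 // ltnS ltnW.
    rewrite !inordK ?ltnS ?(leq_trans a3) ?(leq_trans b3) // /a /b.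
    by do ![case: ifP => ? /=]; lia.
  rewrite leqNgt; apply/negP=> v3p.
  case: (free (ord_max, ord_max)); first by rewrite boxesAP gT orbT.
  by rewrite /=; lia.
rewrite boxesAP; case: a => [[|[|[|[|a]]]] //= _]; case: b => [[|[|[|[|b]]]] //= _];
  case: g good => good //= _ cell; lia.
Qed.

Lemma box_freeB g :
  box_free (boxesB g) X V m p <->
  (x < m -> v1 < p -> m = y \/ m = z \/ p = v2 \/ p = v3) /\ (g -> m < x -> v1 <= p).
Proof.
split=> [free|[box good] [a b]].
  split=> [mz pv3|gT zm].
    pose a : nat := if m < y then 1 else if m < z then 2 else 3.
    pose b : nat := if p < v2 then 1 else if p < v3 then 2 else 3.
    have [ma|] := boolP (m \in [:: y; z]).
      by rewrite !inE in ma; case/orP: ma => /eqP; tauto.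
    have [pb _|] := boolP (p \in [:: v2; v3]).
      by rewrite !inE in pb; case/orP: pb => /eqP; tauto.
    rewrite !inE !negb_or => /andP[p1 p2] /andP[m1 m2].
    have a3 : 0 < a < 4 by rewrite /a; do !case: ifP => // _.
    have b3 : 0 < b < 4 by rewrite /b; do !case: ifP => // _.
    case/andP: a3 => a0 a3; case/andP: b3 => b0 b3.
    case: (free (inord a, inord b)); first by rewrite boxesBP !inordK ?a0 ?b0.
    rewrite !inordK // /a /b.
    by do ![case: ifP => ? /=]; lia.
  rewrite leqNgt; apply/negP=> v3p.
  case: (free (ord0, ord0)); first by rewrite boxesBP gT orbT.
  by rewrite /=; lia.
rewrite boxesBP; case: a => [[|[|[|[|a]]]] //= _]; case: b => [[|[|[|[|b]]]] //= _];
  case: g good => good //= _ cell; lia.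
Qed.

End BoxFree.

Section OccurrenceThree.
Variables (n : nat) (pi : 'S_n) (f : {ffun 'I_3 -> 'I_n}).
Let x := f i0. Let y := f i1. Let z := f i2.

Lemma increasing3 : increasing f = (x < y) && (y < z).
Proof.
apply/idP/andP => [/forallP inc | [xy yz]].
  have inc' (i j : 'I_3) : i < j -> f i < f j by have /forallP/(_ j)/implyP := inc i.
  by split; apply: inc'.
apply/forallP=> i; apply/forallP=> j; apply/implyP; move: j; apply/forall_ord3.
by move: i; apply/forall_ord3; rewrite /= !ltnn /= -/x -/y -/z (ltn_trans xy yz).
Qed.

Lemma order_iso123 : order_iso pi perm123 f = ord123 (pi x) (pi y) (pi z).
Proof.
rewrite /ord123; apply/idP/andP => [/forallP iso | [xy yz]].
  have iso' (i j : 'I_3) : (perm123 i < perm123 j) = (pi (f i) < pi (f j)).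
    by have /forallP/(_ j)/eqP := iso i.
  by rewrite -!iso' !perm1.
apply/forallP=> i; apply/forallP=> j; apply/eqP; rewrite !perm1; move: j; apply/forall_ord3.
have [v0 v1 v2] := val_ord3.
by move: i; apply/forall_ord3; rewrite v0 v1 v2 -/x -/y -/z; split; split; apply/idP/idP; lia.
Qed.

Lemma order_iso132 : order_iso pi perm132 f = ord132 (pi x) (pi y) (pi z).
Proof.
have [v0 v1 v2] := perm132_val.
rewrite /ord132; apply/idP/andP => [/forallP iso | [xy yz]].
  have iso' (i j : 'I_3) : (perm132 i < perm132 j) = (pi (f i) < pi (f j)).
    by have /forallP/(_ j)/eqP := iso i.
  by rewrite -!iso' v0 v1 v2.
apply/forallP=> i; apply/forallP=> j; apply/eqP; move: j; apply/forall_ord3.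
by move: i; apply/forall_ord3; rewrite v0 v1 v2 -/x -/y -/z; split; split; apply/idP/idP; lia.
Qed.

Lemma bounded_positions3 : bounded_positions f = [:: 0; x.+1; y.+1; z.+1; n.+1].
Proof.
rewrite /bounded_positions /image_mem !enum_ordSl enum_ord0 /=.
by rewrite (_ : lift ord0 (lift ord0 ord0) = i2) //; apply: val_inj.
Qed.

Lemma bounded_values123 : ord123 (pi x) (pi y) (pi z) ->
  bounded_values pi f = [:: 0; (pi x).+1; (pi y).+1; (pi z).+1; n.+1].
Proof.
move=> /andP[xy yz].
rewrite /bounded_values /image_mem !enum_ordSl enum_ord0 /=.
rewrite (_ : lift ord0 (lift ord0 ord0) = i2); last by apply: val_inj.
rewrite -/x -/z -[lift ord0 ord0]/i1 -/y.
suff -> : sort leq [:: (pi x).+1; (pi y).+1; (pi z).+1]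
        = [:: (pi x).+1; (pi y).+1; (pi z).+1] by [].
by apply: (sorted_sort leq_trans); rewrite /= !ltnS (ltnW xy) (ltnW yz).
Qed.

Lemma bounded_values132 : ord132 (pi x) (pi y) (pi z) ->
  bounded_values pi f = [:: 0; (pi x).+1; (pi z).+1; (pi y).+1; n.+1].
Proof.
move=> /andP[xy yz].
rewrite /bounded_values /image_mem !enum_ordSl enum_ord0 /=.
rewrite (_ : lift ord0 (lift ord0 ord0) = i2); last by apply: val_inj.
rewrite -/x -/z -[lift ord0 ord0]/i1 -/y.
suff -> : sort leq [:: (pi x).+1; (pi y).+1; (pi z).+1]
        = [:: (pi x).+1; (pi z).+1; (pi y).+1] by [].
apply: (sorted_eq leq_trans anti_leq).
- exact: sort_sorted leq_total _.
- by rewrite /= !ltnS (ltnW xy) (ltnW yz).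
- by rewrite perm_sort perm_cons (perm_catC [:: _] [:: _]).
Qed.

Lemma cells_emptyP (v1 v2 v3 : nat) (R : {set 'I_4 * 'I_4}) :
  bounded_values pi f = [:: 0; v1; v2; v3; n.+1] ->
  reflect (forall m : 'I_n, box_free R [:: 0; x.+1; y.+1; z.+1; n.+1]
                                       [:: 0; v1; v2; v3; n.+1] m.+1 (pi m).+1)
  [forall c in R, cell_empty pi f c].
Proof.
move=> vE; apply: (iffP forallP) => [emp m c cR|emp c].
  have /implyP/(_ cR)/forallP/(_ m) := emp c.
  by rewrite bounded_positions3 vE => /negP.
apply/implyP=> cR; apply/forallP=> m; rewrite bounded_positions3 vE.
by apply/negP; apply: emp.
Qed.

Let pi_eq (m t : 'I_n) : (pi m).+1 = (pi t).+1 -> m = t.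
Proof. by case=> /val_inj/perm_inj. Qed.

Lemma cells_emptyA v1 v2 v3 (g : bool) : x < y < z -> v1 < v2 < v3 ->
  bounded_values pi f = [:: 0; v1.+1; v2.+1; v3.+1; n.+1] ->
  reflect (forall m : 'I_n,
     (m < z -> pi m < v3 ->
        m.+1 = x.+1 \/ m.+1 = y.+1 \/ (pi m).+1 = v1.+1 \/ (pi m).+1 = v2.+1)
     /\ (g -> z < m -> pi m <= v3))
    [forall c in boxesA g, cell_empty pi f c].
Proof.
move=> xyz v123 vE; apply: (iffP (cells_emptyP _ vE)) => free m.
  have [] := (@box_freeA x.+1 y.+1 z.+1 v1.+1 v2.+1 v3.+1 n.+1 m.+1 (pi m).+1
                _ _ _ _ g).1 (free m); rewrite ?ltnS ?v123 ?ltn_ord //.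
by apply/box_freeA; rewrite ?ltnS ?v123 ?ltn_ord //; apply: free.
Qed.

Lemma cells_emptyB v1 v2 v3 (g : bool) : x < y < z -> v1 < v2 < v3 ->
  bounded_values pi f = [:: 0; v1.+1; v2.+1; v3.+1; n.+1] ->
  reflect (forall m : 'I_n,
     (x < m -> v1 < pi m ->
        m.+1 = y.+1 \/ m.+1 = z.+1 \/ (pi m).+1 = v2.+1 \/ (pi m).+1 = v3.+1)
     /\ (g -> m < x -> v1 <= pi m))
    [forall c in boxesB g, cell_empty pi f c].
Proof.
move=> xyz v123 vE; apply: (iffP (cells_emptyP _ vE)) => free m.
  have [] := (@box_freeB x.+1 y.+1 z.+1 v1.+1 v2.+1 v3.+1 n.+1 m.+1 (pi m).+1
                _ _ _ _ g).1 (free m); rewrite ?ltnS ?v123 ?ltn_ord //.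
by apply/box_freeB; rewrite ?ltnS ?v123 ?ltn_ord //; apply: free.
Qed.

Lemma occurrence123A g :
  occurrence pi (perm123, boxesA g) f = triple ord123 g pi x y z.
Proof.
rewrite /occurrence increasing3 order_iso123 /=.
case xyz: (x < y < z); last first.
  by apply/esym/negP=> /tripleP[xy yz _ _ _]; rewrite xy yz in xyz.
case o: (ord123 _ _ _); last first.
  by apply/esym/negP=> /tripleP[_ _]; rewrite o.
have v123 : pi x < pi y < pi z by case/andP: (o) => -> ->.
have /andP[xy yz] := xyz; have /andP[vxy vyz] := v123.
have top : maxn (pi y) (pi z) = pi z by apply/maxn_idPr/ltnW.
apply/(cells_emptyA _ xyz v123 (bounded_values123 o))/tripleP; rewrite top.
  move=> free; split=> // [m|gT m].
    by move=> mz mv; have [/(_ mz mv)] := free m;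
      case=> [[/val_inj]|[[/val_inj]|[/pi_eq|/pi_eq]]] ->; tauto.
  move=> zm; have [_ /(_ gT zm)] := free m.
  by rewrite leq_eqVlt => /orP[/eqP/val_inj/perm_inj e|//]; rewrite e ltnn in zm.
move=> [_ _ _ box good] m; split=> [mz mv|gT zm]; last exact/ltnW/good.
by case: (box m mz mv) => ->; tauto.
Qed.

Lemma occurrence132A g :
  occurrence pi (perm132, boxesA g) f = triple ord132 g pi x y z.
Proof.
rewrite /occurrence increasing3 order_iso132 /=.
case xyz: (x < y < z); last first.
  by apply/esym/negP=> /tripleP[xy yz _ _ _]; rewrite xy yz in xyz.
case o: (ord132 _ _ _); last first.
  by apply/esym/negP=> /tripleP[_ _]; rewrite o.
have v123 : pi x < pi z < pi y by case/andP: (o) => -> ->.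
have /andP[xy yz] := xyz; have /andP[vxz vzy] := v123.
have top : maxn (pi y) (pi z) = pi y by apply/maxn_idPl/ltnW.
apply/(cells_emptyA _ xyz v123 (bounded_values132 o))/tripleP; rewrite top.
  move=> free; split=> // [m|gT m].
    move=> mz mv; have [/(_ mz mv)] := free m.
    case=> [[/val_inj]|[[/val_inj]|[/pi_eq|/pi_eq]]] e; rewrite e in mz *; try tauto.
    (* The value line [v2] belongs here to the last letter, which [m < z] excludes. *)
    by rewrite ltnn in mz.
  move=> zm; have [_ /(_ gT zm)] := free m.
  rewrite leq_eqVlt => /orP[/eqP/val_inj/perm_inj e|//].
  by rewrite e in zm; have := ltn_trans yz zm; rewrite ltnn.
move=> [_ _ _ box good] m; split=> [mz mv|gT zm]; last exact/ltnW/good.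
by case: (box m mz mv) => ->; tauto.
Qed.

End OccurrenceThree.

(** * Reverse-complement and the patterns shaded by B *)

Section ReverseComplement.

Variable n : nat.
Implicit Type pi : 'S_n.

Definition rev_compl pi : 'S_n :=
  perm (inj_comp rev_ord_inj (inj_comp (@perm_inj _ pi) (@rev_ord_inj n))).

Lemma rev_complE pi (x : 'I_n) : rev_compl pi (rev_ord x) = rev_ord (pi x).
Proof. by rewrite permE /= rev_ordK. Qed.

Lemma rev_complK : involutive rev_compl.
Proof.
move=> pi; apply/permP=> x.
by rewrite -[x]rev_ordK rev_complE -[rev_ord x in LHS]rev_ordK rev_complE !rev_ordK.
Qed.

Let ltn_rev (a b : 'I_n) : (rev_ord a < rev_ord b) = (b < a).
Proof. by rewrite /=; have := ltn_ord a; have := ltn_ord b; lia. Qed.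

(** A half turn sends box (a,b) to (3-a,3-b), hence A to B and (3,3) to (0,0). The maximum of the
    last two letters becomes the minimum of the first two. *)
Lemma triple_rev_complP (o : nat -> nat -> nat -> bool) (g : bool) pi (x y z : 'I_n) :
  reflect [/\ x < y, y < z, o (rev_ord (pi z)) (rev_ord (pi y)) (rev_ord (pi x)),
     forall m : 'I_n, x < m -> minn (pi x) (pi y) < pi m -> m = z \/ m = y
   & g -> forall m : 'I_n, m < x -> minn (pi x) (pi y) < pi m]
  (triple o g (rev_compl pi) (rev_ord z) (rev_ord y) (rev_ord x)).
Proof.
have top m : (rev_ord (pi m) < maxn (rev_ord (pi y)) (rev_ord (pi x))) =
             (minn (pi x) (pi y) < pi m).
  by rewrite leq_max gtn_min !ltn_rev orbC.
apply: (iffP (tripleP _ _ _ _ _ _)); rewrite !rev_complE !ltn_rev.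
  move=> [yz xy oxyz box good]; split=> // [m|gT m].
    rewrite -top -ltn_rev -rev_complE => xm mv.
    by have [/rev_ord_inj ->|/rev_ord_inj ->] := box _ xm mv; [left|right].
  by rewrite -top -ltn_rev -rev_complE; apply: good.
move=> [xy yz oxyz box good]; split=> // [m|gT m]; rewrite -[m]rev_ordK.
  rewrite ltn_rev rev_complE top => xm mv.
  by have [->|->] := box _ xm mv; [left|right].
by rewrite ltn_rev rev_complE top; apply: good.
Qed.

End ReverseComplement.

Section OccurrenceThreeB.

Variables (n : nat) (pi : 'S_n) (f : {ffun 'I_3 -> 'I_n}).
Let x := f i0. Let y := f i1. Let z := f i2.

Let pi_eq (m t : 'I_n) : (pi m).+1 = (pi t).+1 -> m = t.
Proof. by case=> /val_inj/perm_inj. Qed.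

Lemma occurrence123B g :
  occurrence pi (perm123, boxesB g) f =
  triple ord123 g (rev_compl pi) (rev_ord z) (rev_ord y) (rev_ord x).
Proof.
have oE : ord123 (rev_ord (pi z)) (rev_ord (pi y)) (rev_ord (pi x)) =
          ord123 (pi x) (pi y) (pi z).
  rewrite /ord123 /=; have := ltn_ord (pi x); have := ltn_ord (pi y).
  by have := ltn_ord (pi z); lia.
rewrite /occurrence increasing3 order_iso123 /= -/x -/y -/z.
apply/and3P/triple_rev_complP; rewrite oE.
  move=> [xyz o]; have /andP[xy yz] := xyz.
  have v123 : pi x < pi y < pi z by case/andP: (o) => -> ->.
  have /andP[vxy vyz] := v123.
  have -> : minn (pi x) (pi y) = pi x by apply/minn_idPl/ltnW.
  move/(cells_emptyB _ xyz v123 (bounded_values123 o)) => free.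
  split=> // [m xm mv|gT m mx].
    by have [/(_ xm mv)] := free m;
      case=> [[/val_inj]|[[/val_inj]|[/pi_eq|/pi_eq]]] ->; tauto.
  have [_ /(_ gT mx)] := free m.
  by rewrite leq_eqVlt => /orP[/eqP/val_inj/perm_inj e|//]; rewrite e ltnn in mx.
move=> [xy yz o]; have xyz : x < y < z by rewrite xy.
have v123 : pi x < pi y < pi z by case/andP: (o) => -> ->.
have /andP[vxy vyz] := v123.
have -> : minn (pi x) (pi y) = pi x by apply/minn_idPl/ltnW.
move=> box good; split=> //.
apply/(cells_emptyB _ xyz v123 (bounded_values123 o)) => m.
split=> [xm mv|gT mx]; last exact/ltnW/good.
by case: (box m xm mv) => ->; tauto.
Qed.

Lemma occurrence132B g :
  occurrence pi (perm132, boxesB g) f =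
  triple ord213 g (rev_compl pi) (rev_ord z) (rev_ord y) (rev_ord x).
Proof.
have oE : ord213 (rev_ord (pi z)) (rev_ord (pi y)) (rev_ord (pi x)) =
          ord132 (pi x) (pi y) (pi z).
  rewrite /ord132 /ord213 /=; have := ltn_ord (pi x); have := ltn_ord (pi y).
  by have := ltn_ord (pi z); lia.
rewrite /occurrence increasing3 order_iso132 /= -/x -/y -/z.
apply/and3P/triple_rev_complP; rewrite oE.
  move=> [xyz o]; have /andP[xy yz] := xyz.
  have v123 : pi x < pi z < pi y by case/andP: (o) => -> ->.
  have /andP[vxz vzy] := v123.
  have -> : minn (pi x) (pi y) = pi x by apply/minn_idPl/ltnW/(ltn_trans vxz).
  move/(cells_emptyB _ xyz v123 (bounded_values132 o)) => free.
  split=> // [m xm mv|gT m mx].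
    by have [/(_ xm mv)] := free m;
      case=> [[/val_inj]|[[/val_inj]|[/pi_eq|/pi_eq]]] ->; tauto.
  have [_ /(_ gT mx)] := free m.
  by rewrite leq_eqVlt => /orP[/eqP/val_inj/perm_inj e|//]; rewrite e ltnn in mx.
move=> [xy yz o]; have xyz : x < y < z by rewrite xy.
have v123 : pi x < pi z < pi y by case/andP: (o) => -> ->.
have /andP[vxz vzy] := v123.
have -> : minn (pi x) (pi y) = pi x by apply/minn_idPl/ltnW/(ltn_trans vxz).
move=> box good; split=> //.
apply/(cells_emptyB _ xyz v123 (bounded_values132 o)) => m.
split=> [xm mv|gT mx]; last exact/ltnW/good.
by case: (box m xm mv) => ->; tauto.
Qed.

End OccurrenceThreeB.

(** * Counting occurrences by their pairs, and conclusion *)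

Lemma triple_inj (o : nat -> nat -> nat -> bool) g n (pi : 'S_n) (x y x' y' z : 'I_n) :
  (forall a b c, o a b c -> a < maxn b c) ->
  triple o g pi x y z -> triple o g pi x' y' z ->
  maxn (pi y) (pi z) = maxn (pi y') (pi z) -> x = x' /\ y = y'.
Proof.
move=> o_top /tripleP[xy yz _ box _] /tripleP[xy' yz' /o_top xtop' _ _] e.
have neq (m t : 'I_n) : m < t -> pi m <> pi t :> nat.
  by move=> mt /val_inj/perm_inj e'; rewrite e' ltnn in mt.
have nyz := neq _ _ yz; have nyz' := neq _ _ yz'.
(* The letter at [x'] is left of [z] and below the common maximum, so it lies in the region where
   the first triple allows only [x] and [y]. *)
have x'xy : x' = x \/ x' = y by apply: box; [exact: ltn_trans xy' yz' | rewrite e].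
(* If the maximum is at [z], the same holds for [y'], and [x' < y'] fixes the order. Otherwise the
   maximum is at both [y] and [y'], which therefore coincide. *)
have [yltz|zley] := ltnP (pi y) (pi z).
  have y'xy : y' = x \/ y' = y.
    by apply: box => //; move: nyz nyz' e yltz; clear; lia.
  by case: x'xy y'xy xy' => -> [] ->; rewrite ?ltnn // => /(ltn_trans xy); rewrite ltnn.
have ey : y = y'.
  by apply/(@perm_inj _ pi)/val_inj; move: nyz nyz' e zley => /=; clear; lia.
by case: x'xy xy' => ->; rewrite ey // ltnn.
Qed.

Lemma card_triple (o : nat -> nat -> nat -> bool) g n (pi : 'S_n) :
  (forall a b c, o a b c -> a < maxn b c) ->
  #|[set f : {ffun 'I_3 -> 'I_n} | triple o g pi (f i0) (f i1) (f i2)]| =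
  #|top_right o g pi|.
Proof.
move=> o_top.
(* The maximum as an element of ['I_n], so that the pair has the type of the members of
   [top_right]. *)
pose top (y z : 'I_n) := if pi y < pi z then pi z else pi y.
have topE y z : top y z = maxn (pi y) (pi z) :> nat by rewrite /top /maxn; case: ifP.
rewrite -(@card_in_imset _ _ (fun f : {ffun 'I_3 -> 'I_n} => (f i2, top (f i1) (f i2)))).
  congr #|pred_of_set _|; apply/setP=> -[z v]; apply/imsetP/top_rightP.
    by case=> f; rewrite inE => t [-> ->]; exists (f i0), (f i1).
  move=> [x [y [t v_def]]]; exists [ffun i : 'I_3 => tnth [tuple x; y; z] i].
    by rewrite inE !ffunE !(tnth_nth x).
  by rewrite !ffunE !(tnth_nth x) /=; congr pair; apply: val_inj; rewrite /= v_def topE.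
move=> f f'; rewrite !inE => t t' [ez et].
have {}et := congr1 val et; rewrite /= !topE in et.
rewrite -ez in t' et; have [ex ey] := triple_inj o_top t t' et.
by apply/ffunP; apply/forall_ord3.
Qed.

Lemma card_triple_rev (o : nat -> nat -> nat -> bool) g n (pi : 'S_n) :
  #|[set f : {ffun 'I_3 -> 'I_n} |
      triple o g pi (rev_ord (f i2)) (rev_ord (f i1)) (rev_ord (f i0))]| =
  #|[set f : {ffun 'I_3 -> 'I_n} | triple o g pi (f i0) (f i1) (f i2)]|.
Proof.
(* Reversing the positions also reverses the order in which the letters are listed, so indices are
   reversed on both sides. *)
pose rv (f : {ffun 'I_3 -> 'I_n}) := [ffun i => rev_ord (f (rev_ord i))].
have rvK : involutive rv by move=> f; apply/ffunP=> i; rewrite !ffunE !rev_ordK.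
rewrite -!sum1dep_card [RHS](reindex_inj (inv_inj rvK)) /=.
apply: eq_bigl => f; rewrite !ffunE.
have [-> -> ->] // : [/\ rev_ord i0 = i2, rev_ord i1 = i1 & rev_ord i2 = i0].
by split; apply: val_inj.
Qed.

Lemma ord123_top a b c : ord123 a b c -> a < maxn b c.
Proof. by rewrite /ord123; lia. Qed.

Lemma ord213_top a b c : ord213 a b c -> a < maxn b c.
Proof. by rewrite /ord213; lia. Qed.

Lemma ord132_top a b c : ord132 a b c -> a < maxn b c.
Proof. by rewrite /ord132; lia. Qed.

(** For each [g], all four counts are reduced to the same number, so pairwise equality needs no case
    analysis on pairs of patterns. *)
Lemma card_occurrences g n l (p : mesh_pattern 3) :
  p \in [:: (perm123, boxesA g); (perm132, boxesA g);
            (perm123, boxesB g); (perm132, boxesB g)] ->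
  #|[set pi : 'S_n | num_occurrences pi p == l]| = num_top_right g ord123 n l.
Proof.
have rev_compl_card o : #|[set pi : 'S_n | #|top_right o g (rev_compl pi)| == l]| =
    num_top_right g o n l.
  by rewrite /num_top_right -!sum1dep_card
             [RHS](reindex_inj (inv_inj (@rev_complK n))).
rewrite !inE => /or4P[]/eqP ->.
- rewrite /num_top_right; apply: eq_card => pi; rewrite !inE -(card_triple _ _ ord123_top).
  by congr (_ == _); apply: eq_card => f; rewrite !inE occurrence123A.
- rewrite -num_top_right132; apply: eq_card => pi; rewrite !inE -(card_triple _ _ ord132_top).
  by congr (_ == _); apply: eq_card => f; rewrite !inE occurrence132A.
- rewrite -rev_compl_card; apply: eq_card => pi; rewrite !inE -(card_triple _ _ ord123_top).
  rewrite -card_triple_rev.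
  by congr (_ == _); apply: eq_card => f; rewrite !inE occurrence123B.
- rewrite -num_top_right213 -rev_compl_card; apply: eq_card => pi.
  rewrite !inE -(card_triple _ _ ord213_top) -card_triple_rev.
  by congr (_ == _); apply: eq_card => f; rewrite !inE occurrence132B.
Qed.

Theorem theorem4p3 :
  (forall p q : mesh_pattern 3,
     p \in [:: (perm123, boxA); (perm132, boxA);
               (perm123, boxB); (perm132, boxB)] ->
     q \in [:: (perm123, boxA); (perm132, boxA);
               (perm123, boxB); (perm132, boxB)] ->
     equidistributed p q) /\
  (forall p q : mesh_pattern 3,
     p \in [:: (perm123, boxA :|: [set box33]); (perm132, boxA :|: [set box33]);
               (perm123, boxB :|: [set box00]); (perm132, boxB :|: [set box00])] ->
     q \in [:: (perm123, boxA :|: [set box33]); (perm132, boxA :|: [set box33]);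
               (perm123, boxB :|: [set box00]); (perm132, boxB :|: [set box00])] ->
     equidistributed p q).
Proof.
split=> p q pP qP n l.
  (* The flag selects the family: [boxesA] and [boxesB] compute to the plain shadings at [false] and
     to the enlarged ones at [true]. *)
  by rewrite !(@card_occurrences false).
by rewrite !(@card_occurrences true).
Qed.
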